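(* Let $\varepsilon>0$ be a fixed number. Apply Algorithm B (described in the context) to the problem of minimizing $f(x)$ over $x\in X$ subject to $g_m(x)\le0$ for all $m=1,\dots,M$, and suppose the stopping criterion of Algorithm B is satisfied. Then $$\min_{k\in I}v_f(x^k,x_* )<\varepsilon,$$ where $I$ is the set of indices of productive steps and, for $x,y\in X$, $v_f(x,y)=\left\langle\frac{\nabla f(x)}{\|\nabla f(x)\|_*},x-y\right\rangle$ if $\nabla f(x)\ne0$ and $v_f(x,y)=0$ if $\nabla f(x)=0$. Moreover, Algorithm B performs at most $$N=\left\lceil\frac{2\max\{1,M_g^2\}\,\Theta_0^2}{\varepsilon^2}\right\rceil$$ iterations.
   Context: Setting. $(E,\|\cdot\|)$ is a finite-dimensional normed vector space, $E^*$ its dual with norm $\|y\|_*=\max\{\langle y,x\rangle:\|x\|\le1\}$, and $X\subset E$ is a closed convex set. The functions $f,g_1,\dots,g_M:X\to\mathbb{R}$ are convex and subdifferentiable, and there is a constant $M_g$ with $|g_m(x)-g_m(y)|\le M_g\|x-y\|$ for all $x,y\in X$ and all $m=1,\dots,M$ ($f$ is not assumed Lipschitz). Put $g(x)=\max_{1\le m\le M}g_m(x)$. The problem is: minimize $f(x)$ over $x\in X$ subject to $g_m(x)\le0$ for all $m=1,\dots,M$. It is assumed to be solvable. Prox structure. $d:X\to\mathbb{R}$ is continuously differentiable and $1$-strongly convex with respect to $\|\cdot\|$, i.e. $\langle\nabla d(x)-\nabla d(y),x-y\rangle\ge\|x-y\|^2$ for all $x,y\in X$, and $\min_{x\in X}d(x)=d(0)$.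 The constant $\Theta_0>0$ satisfies $d(x_* )\le\Theta_0^2$, where $x_*$ is an exact solution of the problem (if there is a set $X_*$ of solutions, it is assumed that $\min_{x_*\in X_*}d(x_* )\le\Theta_0^2$). The Bregman divergence is $V(x,y)=d(y)-d(x)-\langle\nabla d(x),y-x\rangle$ and, for $x\in X$, $p\in E^*$, $$\mathrm{Mirr}_x(p)=\arg\min_{u\in X}\{\langle p,u\rangle+V(x,u)\},$$ which is assumed to be easily computable. Subgradients. $\nabla f(x)$ and $\nabla g_m(x)$ denote subgradients of $f$ and $g_m$ at $x$. All subgradients used in the algorithm are assumed nonzero (if $\nabla f(x^k)=0$, then $x^k$ already minimizes $f$ and the method is stopped). Algorithm B. Input: $\varepsilon>0$ and $\Theta_0$ with $d(x_* )\le\Theta_0^2$. Set $x^0=\arg\min_{x\in X}d(x)$, $I=\emptyset$, $N=0$. Repeat: - If $g(x^N)\le\varepsilon$ (productive step): set $h_N=\varepsilon/\|\nabla f(x^N)\|_*$, $x^{N+1}=\mathrm{Mirr}_{x^N}(h_N\nabla f(x^N))$, and add $N$ to $I$. - Otherwise (non-productive step): $g_{m(N)}(x^N)>\varepsilon$ for some $m(N)\in\{1,\dots,M\}$; take any such $m(N)$ and set $h_N=\varepsilon/\|\nabla g_{m(N)}(x^N)\|_*^2$, $x^{N+1}=\mathrm{Mirr}_{x^N}(h_N\nabla g_{m(N)}(x^N))$. - Replace $N$ by $N+1$. Stop as soon as $\Theta_0^2\le\frac{\varepsilon^2}{2}\left(|I|+\sum_{k\notin I}\frac{1}{\|\nabla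 g_{m(k)}(x^k)\|_*^2}\right)$, where the sum is over $k\in\{0,\dots,N-1\}\setminus I$ (the stopping criterion). Output: $\bar{x}^N=\arg\min_{x^k,\,k\in I}f(x^k)$.
   Formalization: Mends: d(0) ≥ 0 is assumed; the minimum is ≤ ε, and < ε unless all steps are productive, x^N = x_*, d(x_* ) = Θ_0² and the stopping criterion is an equality; the iteration bound assumes ‖∇g_m(x^k)‖_* ≤ M_g at non-productive x^k not interior to X. *)

(* Defs.v *)
From HB Require Import structures.
From mathcomp Require Import all_boot all_order all_algebra.
From mathcomp Require Import all_classical all_reals all_analysis.

Set Implicit Arguments.
Unset Strict Implicit.
Unset Printing Implicit Defensive.

Import Order.TTheory GRing.Theory Num.Theory.
Import numFieldNormedType.Exports.

Local Open Scope classical_set_scope.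
Local Open Scope ring_scope.

(* Functions on the feasible set X are total functions on E of which only the
   values on X are ever used.  In finite dimension every linear form is
   continuous, so that E^* is {linear E -> R^o}. *)

Definition finite_dimensional (R : realType) (E : normedModType R) : Prop :=
  exists (n : nat) (b : 'I_n -> E),
    forall v : E, exists c : 'I_n -> R, v = \sum_(i < n) c i *: b i.

Definition dual_norm (R : realType) (E : normedModType R) (p : E -> R) : R :=
  sup [set p x | x in [set x : E | `|x| <= 1]].

Definition is_argmin (R : realType) (E : normedModType R) (A : set E)
    (F : E -> R) (z : E) : Prop :=
  A z /\ forall u, A u -> F z <= F u.

Definition is_subgradient (R : realType) (E : normedModType R) (X : set E)
    (f : E -> R) (x : E) (s : {linear E -> R^o}) : Prop :=
  forall y, X y -> f x + s (y - x) <= f y.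

(* Frechet differentiability relative to X, i.e. as y tends to x inside X: X
   need not be open, nor even have interior points. *)
Definition is_C1_on (R : realType) (E : normedModType R) (X : set E)
    (d : E -> R) (gradd : E -> {linear E -> R^o}) : Prop :=
  (forall x, X x -> forall e : R, 0 < e ->
     \forall y \near within X (nbhs x),
       `|d y - d x - gradd x (y - x)| <= e * `|y - x|) /\
  (forall x, X x ->
     dual_norm (gradd y \- gradd x) @[y --> within X (nbhs x)] --> (0 : R)).

Definition strongly_convex1_on (R : realType) (E : normedModType R) (X : set E)
    (gradd : E -> {linear E -> R^o}) : Prop :=
  forall x y, X x -> X y -> `|x - y| ^+ 2 <= gradd x (x - y) - gradd y (x - y).

Definition bregman (R : realType) (E : normedModType R) (d : E -> R)
    (gradd : E -> {linear E -> R^o}) (x y : E) : R :=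
  d y - d x - gradd x (y - x).

(* is_mirr X d gradd x p z : z = Mirr_x(p) *)
Definition is_mirr (R : realType) (E : normedModType R) (X : set E)
    (d : E -> R) (gradd : E -> {linear E -> R^o}) (x : E) (p : E -> R) (z : E)
    : Prop :=
  is_argmin X (fun u => p u + bregman d gradd x u) z.

(* The constraint functions are indexed by 'I_M.+1, so that there is at least
   one of them. *)
Definition max_constraint (R : realType) (E : normedModType R) (M : nat)
    (g : 'I_M.+1 -> E -> R) (x : E) : R :=
  \big[Num.max/g ord0 x]_(m < M.+1) g m x.

Definition feasible (R : realType) (E : normedModType R) (X : set E) (M : nat)
    (g : 'I_M.+1 -> E -> R) : set E :=
  [set x | X x /\ forall m, g m x <= 0].

Definition productive (R : realType) (E : normedModType R) (M : nat)
    (g : 'I_M.+1 -> E -> R) (eps : R) (x : E) : bool :=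
  max_constraint g x <= eps.

(* One iteration from z to z'; m is the violated constraint selected if the
   step is non-productive, and is irrelevant otherwise. *)
Definition algB_step (R : realType) (E : normedModType R) (X : set E)
    (d : E -> R) (gradd : E -> {linear E -> R^o})
    (gradf : E -> {linear E -> R^o}) (M : nat) (g : 'I_M.+1 -> E -> R)
    (gradg : 'I_M.+1 -> E -> {linear E -> R^o}) (eps : R)
    (z : E) (m : 'I_M.+1) (z' : E) : Prop :=
  if productive g eps z then
    (gradf z : E -> R) <> cst 0 /\
    is_mirr X d gradd z (fun u => eps / dual_norm (gradf z) * gradf z u) z'
  else
    [/\ eps < g m z,
        (gradg m z : E -> R) <> cst 0 &
        is_mirr X d gradd z
          (fun u => eps / dual_norm (gradg m z) ^+ 2 * gradg m z u) z'].

(* The stopping criterion, tested after N iterations. *)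
Definition algB_stop (R : realType) (E : normedModType R) (M : nat)
    (g : 'I_M.+1 -> E -> R) (gradg : 'I_M.+1 -> E -> {linear E -> R^o})
    (eps Theta0 : R) (x : nat -> E) (m : nat -> 'I_M.+1) (N : nat) : Prop :=
  Theta0 ^+ 2 <=
    eps ^+ 2 / 2 *
      (#|[pred k : 'I_N | productive g eps (x k)]|%:R +
       \sum_(k < N | ~~ productive g eps (x k))
          (dual_norm (gradg (m k) (x k)) ^+ 2)^-1).

(* The first N iterations are performed: the method has not stopped before. *)
Definition algB_run (R : realType) (E : normedModType R) (X : set E)
    (d : E -> R) (gradd : E -> {linear E -> R^o})
    (gradf : E -> {linear E -> R^o}) (M : nat) (g : 'I_M.+1 -> E -> R)
    (gradg : 'I_M.+1 -> E -> {linear E -> R^o}) (eps Theta0 : R)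
    (x : nat -> E) (m : nat -> 'I_M.+1) (N : nat) : Prop :=
  is_argmin X d (x 0%N) /\
  forall n, (n < N)%N ->
    ~ algB_stop g gradg eps Theta0 x m n /\
    algB_step X d gradd gradf g gradg eps (x n) (m n) (x n.+1).

Definition v_f (R : realType) (E : normedModType R)
    (gradf : E -> {linear E -> R^o}) (x y : E) : R :=
  if `[< (gradf x : E -> R) = cst 0 >] then 0
  else gradf x (x - y) / dual_norm (gradf x).

(* Minimum over the productive steps among the first N ones, in the extended
   reals: it is +oo if there is none, so that a finite upper bound entails that
   there is one. *)
Definition min_v_f (R : realType) (E : normedModType R)
    (gradf : E -> {linear E -> R^o}) (M : nat) (g : 'I_M.+1 -> E -> R)
    (eps : R) (x : nat -> E) (xs : E) (N : nat) : \bar R :=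
  \big[mine/+oo%E]_(k < N | productive g eps (x k)) (v_f gradf (x k) xs)%:E.

(* The coincidence in which min_v_f can be equal to eps: all the inequalities
   summed up in the analysis of the method are then equalities.  It does occur:
   for X = ]-oo, 1], f x = - x, d x = x ^+ 2 / 2, g = -1, eps = 1 and
   Theta0 ^+ 2 = 1 / 2, one step leads from 0 to the solution 1, the stopping
   criterion holds with equality and v_f 0 1 = 1. *)
Definition tight_run (R : realType) (E : normedModType R) (d : E -> R)
    (M : nat) (g : 'I_M.+1 -> E -> R) (eps Theta0 : R)
    (x : nat -> E) (xs : E) (N : nat) : Prop :=
  [/\ forall k, (k < N)%N -> productive g eps (x k),
      x N = xs,
      d xs = Theta0 ^+ 2 &
      Theta0 ^+ 2 = eps ^+ 2 / 2 * N%:R].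

(* Main.v *)
Require Import Defs.
From HB Require Import structures.
From mathcomp Require Import all_boot all_order all_algebra.
From mathcomp Require Import all_classical all_reals all_analysis.
From mathcomp Require Import ring lra.

(** Each step of the method is a mirror descent step, for which the first-order
    optimality of Mirr and the bound V(z, z') >= |z - z'|^2 / 2 give
      c p(z - u) <= c^2 |p|_*^2 / 2 + V(z, u) - V(z', u)
    for every u of X ([mirr_step_le]).  The first ingredient is differentiation
    of the objective along segments of X ([argmin_first_order]); the second is
    the mean value theorem applied to d along [z, z'], of which the derivative
    grows at least linearly by strong monotonicity ([bregman_ge]).

    At u = xs, a productive step thus yields
      eps v_f(x_k, xs) <= eps^2 / 2 + V(x_k, xs) - V(x_k+1, xs),
    while at a non-productive step the subgradient inequality gives
    s(x_k - xs) >= g_m(x_k) - g_m(xs) > eps for the chosen subgradient s, hence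
      eps^2 / (2 |s|_*^2) < V(x_k, xs) - V(x_k+1, xs).
    Suppose that v_f(x_k, xs) >= eps at all productive steps.  Summing up, the
    right-hand side of the stopping criterion is at most
      V(x_0, xs) - V(x_N, xs) <= d(xs) <= Theta0^2
    since x_0 minimises d and d is nonnegative ([bregman_argmin_le]),
    and the criterion is the reverse inequality, so that equality holds
    everywhere: there is no non-productive step, each v_f(x_k, xs) is eps, and
    V(x_N, xs) = 0, that is x_N = xs ([algB_stop_tight]).  Both estimates of the
    minimum of v_f follow by contradiction.

    For the iteration bound, every term of the sum in the criterion is at least
    1 / max(1, Mg^2) ([step_weight_ge]): a subgradient of an Mg-Lipschitz
    function at an interior point of X has dual norm at most Mg
    ([interior_subgradient_le]), and at the other points of X this is
    assumed.  The failure of the criterion one step earlier bounds the number of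
    terms.

    The inequality p(v) <= |p|_* |v| holds only because the supremum defining
    the dual norm is that of a bounded set, which is where finite dimension is
    used ([linear_form_bounded]).  Values of linear forms live in [R^o]; they
    are often renamed as functions to [R], for the sake of real arithmetic. *)

Set Implicit Arguments.
Unset Strict Implicit.
Unset Printing Implicit Defensive.

Import Order.TTheory GRing.Theory Num.Theory.
Import numFieldNormedType.Exports.

Local Open Scope classical_set_scope.
Local Open Scope ring_scope.

(** * Linear forms on finite-dimensional spaces *)

Lemma norm_coord_le (R : realType) (n : nat) (c : 'rV[R]_n) (i : 'I_n) :
  `|c ord0 i| <= `|c|.
Proof.
rewrite [leRHS]/Num.norm /= mx_normrE; apply/bigmax_geP; right => /=.
by exists (ord0, i).
Qed.

Lemma norm_lincomb_le (R : realType) (W : normedModType R) (n : nat)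
    (b : 'I_n -> W) (c : 'rV[R]_n) :
  `|\sum_i c ord0 i *: b i| <= `|c| * \sum_i `|b i|.
Proof.
apply: le_trans (ler_norm_sum _ _ _) _; rewrite mulr_sumr.
by apply: ler_sum => i _; rewrite normrZ ler_wpM2r ?norm_coord_le.
Qed.

Lemma finite_dimensional_basis (R : realType) (E : normedModType R) :
  finite_dimensional E ->
  exists (n : nat) (b : 'I_n -> E),
    (forall v, exists c : 'rV[R]_n, v = \sum_i c ord0 i *: b i) /\
    (forall c : 'rV[R]_n, \sum_i c ord0 i *: b i = 0 -> c = 0).
Proof.
move=> finE.
pose P n := `[< exists b : 'I_n -> E,
  forall v : E, exists c : 'I_n -> R, v = \sum_(i < n) c i *: b i >].
have exP : exists n, P n by have [n nb] := finE; exists n; apply/asboolP.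
(* A spanning family of minimal size is free. *)
case: (ex_minnP exP) => n /asboolP[b spanb] minn; exists n, b; split.
  move=> v; have [c ->] := spanb v; exists (\row_i c i).
  by apply: eq_bigr => i _; rewrite mxE.
move=> c c0; apply/eqP/negPn/negP => /eqP c_neq0.
(* Otherwise b i0 can be eliminated by means of the relation c. *)
have [i0 ci0] : exists i, c ord0 i != 0.
  apply/existsP; apply: contra_notT c_neq0 => /existsPn c_eq0.
  by apply/rowP => i; rewrite mxE; apply/eqP/negPn; exact: c_eq0.
suff : P n.-1.
  move=> /minn; rewrite leqNgt prednK ?leqnn//.
  exact: leq_ltn_trans (ltn_ord i0).
apply/asboolP; exists (b \o lift i0) => v; have [a va] := spanb v.
pose a' i := a i - a i0 / c ord0 i0 * c ord0 i; exists (a' \o lift i0).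
have -> : v = \sum_i a' i *: b i.
  rewrite /a'; under eq_bigr do rewrite scalerBl -scalerA.
  by rewrite sumrB -scaler_sumr c0 scaler0 subr0.
by rewrite (bigD1_ord i0)//= /a' divfK// subrr scale0r add0r.
Qed.

(** The image of the unit sphere of the coordinate space, which is compact,
    stays away from 0. *)
Lemma basis_norm_ge (R : realType) (E : normedModType R) (n : nat)
    (b : 'I_n -> E) :
  (forall c : 'rV[R]_n, \sum_i c ord0 i *: b i = 0 -> c = 0) ->
  exists2 delta : R, 0 < delta &
    forall c : 'rV[R]_n, delta * `|c| <= `|\sum_i c ord0 i *: b i|.
Proof.
move=> freeb; pose phi (c : 'rV[R]_n) : E := \sum_i c ord0 i *: b i.
pose S := [set c : 'rV[R]_n | `|c| = 1].
have phiZ a c : phi (a *: c) = a *: phi c.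
  rewrite /phi scaler_sumr; apply: eq_bigr => i _.
  by rewrite mxE scalerA.
have unitS c : c != 0 -> S (`|c|^-1 *: c).
  move=> c0; rewrite /S /= normrZ ger0_norm ?invr_ge0//.
  by rewrite mulVf ?normr_eq0.
have [S0|/set0P/negP] := pselect (S !=set0); last first.
  rewrite negbK => /eqP S0; exists 1 => // c.
  have [->|/unitS] := eqVneq c 0; first by rewrite normr0 mulr0.
  by rewrite S0.
have compactS : compact S.
  apply: bounded_closed_compact.
    exists 1; split; first exact: num_real.
    by move=> r r1 c /= ->; exact: ltW.
  apply: (@closed_comp _ _ (fun c : 'rV[R]_n => `|c|) [set 1]).
    by move=> c _; exact: norm_continuous.
  exact: closed_eq.
have cont_phi : {within S, continuous (fun c => `|phi c|)}.
  apply: continuous_subspaceT => c.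
  suff cphi : phi c' @[c' --> (c : 'rV[R]_n)] --> phi c by exact: cvg_norm cphi.
  apply/(@cvgrPdist_lt _ _ _ (nbhs (c : 'rV[R]_n))) => e e0.
  pose B := \sum_i `|b i|.
  have B1 : 0 < B + 1 by rewrite ltr_wpDl// sumr_ge0.
  near=> c'.
  have -> : phi c - phi c' = phi (c - c').
    rewrite /phi -sumrB; apply: eq_bigr => i _.
    by rewrite !mxE scalerBl.
  apply: le_lt_trans (norm_lincomb_le _ _) _.
  apply: (@le_lt_trans _ _ (`|c - c'| * (B + 1))).
    by rewrite ler_wpM2l// lerDl.
  rewrite -ltr_pdivlMr//; near: c'.
  by apply: cvgr_dist_lt; rewrite ?divr_gt0//; exact: cvg_id.
have [c0 c0S minc0] := EVT_min_rV S0 compactS cont_phi.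
have phic0 : 0 < `|phi c0|.
  rewrite normr_gt0; apply/eqP => /freeb c00.
  by move: c0S; rewrite inE /S /= c00 normr0 => /eqP; rewrite eq_sym oner_eq0.
exists `|phi c0| => // c.
have [->|c_neq0] := eqVneq c 0; first by rewrite normr0 mulr0.
have := minc0 (`|c|^-1 *: c); rewrite inE => /(_ (unitS _ c_neq0)).
rewrite phiZ normrZ ger0_norm ?invr_ge0// mulrC ler_pdivlMr//.
by rewrite normr_gt0.
Unshelve. all: by end_near. Qed.

(** Linear forms on a finite-dimensional space are bounded. *)
Lemma linear_form_bounded (R : realType) (E : normedModType R) :
  finite_dimensional E -> forall p : {linear E -> R^o},
  exists C : R, forall v, `|p v| <= C * `|v|.
Proof.
move=> /finite_dimensional_basis[n [b [spanb freeb]]] p.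
have [delta delta0 phiP] := basis_norm_ge freeb.
pose B := \sum_i `|p (b i) : R|.
exists (B / delta) => v; have [c ->] := spanb v.
rewrite linear_sum; under eq_bigr do rewrite linearZ.
apply: le_trans (@norm_lincomb_le R R^o n (p \o b) c) _.
rewrite mulrC -mulrA ler_wpM2l ?sumr_ge0//.
by rewrite mulrC ler_pdivlMr// mulrC.
Qed.

(** * The dual norm *)

Lemma finite_dimensional_has_sup_dual_norm (R : realType) (E : normedModType R)
    (p : {linear E -> R^o}) :
  finite_dimensional E ->
  has_sup [set (p x : R) | x in [set x : E | `|x| <= 1]].
Proof.
move=> /linear_form_bounded/(_ p)[C pC]; split.
  by exists (p 0 : R); exists 0; rewrite //= normr0.
exists `|C| => _ [v /= v1 <-].
apply: le_trans (ler_norm _) _; apply: le_trans (pC v) _.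
apply: le_trans (ler_wpM2r _ (ler_norm C)) _ => //.
by rewrite -[leRHS]mulr1 ler_wpM2l.
Qed.

(** In finite dimension the supremum that defines the dual norm is that of a
    bounded set; hence the Cauchy-Schwarz inequality for the duality. *)
Lemma dual_norm_ge (R : realType) (E : normedModType R)
    (p : {linear E -> R^o}) (v : E) :
  finite_dimensional E -> p v <= dual_norm p * `|v|.
Proof.
move=> finE; have [->|v0] := eqVneq v 0.
  by rewrite linear0 normr0 mulr0.
rewrite -ler_pdivrMr ?normr_gt0// mulrC.
have -> : `|v|^-1 * p v = p (`|v|^-1 *: v) by rewrite linearZ.
apply: sup_upper_bound; first exact: finite_dimensional_has_sup_dual_norm.
exists (`|v|^-1 *: v) => //=.
by rewrite normrZ normfV normr_id mulVf ?normr_eq0.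
Qed.

Lemma dual_norm_gt0 (R : realType) (E : normedModType R)
    (p : {linear E -> R^o}) :
  finite_dimensional E -> (p : E -> R) <> cst 0 -> 0 < dual_norm p.
Proof.
move=> finE p0; rewrite ltNge; apply/negP => np.
have pneg v : p v <= 0.
  by apply: le_trans (dual_norm_ge p v finE) _; rewrite mulr_le0_ge0.
apply: p0; apply/funext => v; apply/eqP; rewrite eq_le pneg/=.
by have := pneg (- v); rewrite linearN oppr_le0.
Qed.

(** The constant is not assumed nonnegative: this follows from the form being
    nonzero. *)
Lemma dual_norm_le (R : realType) (E : normedModType R)
    (p : {linear E -> R^o}) (C : R) :
  (p : E -> R) <> cst 0 -> (forall v, p v <= C * `|v|) -> dual_norm p <= C.
Proof.
move=> p0 pC.
have C0 : 0 <= C.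
  rewrite leNgt; apply/negP => C0; apply: p0; apply/funext => v.
  have -> : v = 0; last by rewrite linear0.
  apply/eqP; rewrite -normr_le0 leNgt; apply/negP => v0.
  have Cv : C * `|v| < 0 by rewrite nmulr_rlt0.
  have := le_lt_trans (pC (- v)); rewrite normrN => /(_ _ Cv).
  rewrite linearN oppr_lt0 => pv; have := lt_trans pv (le_lt_trans (pC v) Cv).
  by rewrite ltxx.
apply: ge_sup; first by exists (p 0 : R); exists 0; rewrite //= normr0.
move=> _ [v /= v1 <-]; apply: le_trans (pC v) _.
by rewrite -[leRHS]mulr1 ler_wpM2l.
Qed.

(** * Differentiation relative to a convex set *)

(** Frechet differentiability of [F] at [x] relative to [A], with derivative
    [L]: the increment [y - x] tends to 0 with [y] in [A].  Linearity of [L] is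
    left to the lemmas that need it. *)
Definition has_derivative_within (R : realType) (E : normedModType R)
    (A : set E) (F : E -> R) (x : E) (L : E -> R) : Prop :=
  forall e : R, 0 < e ->
    \forall y \near within A (nbhs x), `|F y - F x - L (y - x)| <= e * `|y - x|.

Lemma convex_segment (R : realType) (E : normedModType R) (X : set E)
    (x y : E) (t : R) :
  convex_set X -> X x -> X y -> t \in `[0, 1]%R -> X (x + t *: (y - x)).
Proof.
move=> convX Xx Xy; rewrite in_itv/= => /andP[t0 t1].
have := convX y x (Itv01 t0 t1); rewrite !inE => /(_ Xy Xx).
by congr X; rewrite /conv/= /unstable.onem scalerBl scale1r scalerBr addrCA.
Qed.

Lemma has_derivative_within_segment (R : realType) (E : normedModType R)
    (X : set E) (F : E -> R) (x y : E) (t : R) (L : {linear E -> R^o}) :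
  convex_set X -> X x -> X y ->
  has_derivative_within X F (x + t *: (y - x)) L ->
  @has_derivative_within R R^o [set` `[(0 : R), 1]]
    (fun s => F (x + s *: (y - x))) t (fun s => s * L (y - x)).
Proof.
move=> convX Xx Xy dF e e0.
have c0 : 0 < `|y - x| + 1 by rewrite ltr_wpDl.
have /(_ _ (divr_gt0 e0 c0)) := dF; rewrite !near_withinE.
have cont : x + s *: (y - x) @[s --> t] --> x + t *: (y - x).
  by apply: cvgD; [exact: cvg_cst|exact: cvgZr_tmp].
move=> /cont; apply: (@filterS R (nbhs t)) => s /= dFs s01.
have := dFs (convex_segment convX Xx Xy s01).
rewrite opprD addrACA subrr add0r -scalerBl linearZ/= => /le_trans; apply.
rewrite normrZ mulrCA mulrC ler_wpM2r// -mulrA.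
by rewrite ler_piMr ?(ltW e0)// mulrC ler_pdivrMr// mul1r lerDl.
Qed.

Lemma has_derivative_within_is_derive (R : realType) (phi : R -> R) (a t : R) :
  t \in `]0, 1[%R ->
  @has_derivative_within R R^o [set` `[(0 : R), 1]] phi t
    (fun s => s * a) ->
  is_derive t 1 phi a.
Proof.
rewrite in_itv/= => /andP[t0 t1] dphi.
suff cvga : h^-1 *: ((phi \o shift t) (h *: 1) - phi t) @[h --> 0^'] --> a.
  apply: DeriveDef; first by apply/cvg_ex; exists a.
  exact: cvg_lim cvga.
apply/cvgrPdist_le => e e0.
have /dphi := e0; rewrite near_withinE => /nbhs0P dphie.
near=> h.
have h0 : h != 0 by near: h; exact: nbhs_dnbhs_neq.
have ht : `|h| < Num.min t (1 - t).
  by near: h; apply: dnbhs0_lt; rewrite lt_min t0 subr_gt0.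
have : [set` `[(0 : R), 1]] (t + h) ->
    `|phi (t + h) - phi t - (t + h - t) * a| <= e * `|t + h - t|.
  by near: h; apply: nbhs_dnbhs.
rewrite [t + h - t]addrAC subrr add0r => dphih.
rewrite /= distrC -[a](mulKf h0) /GRing.scale/= mulr1 -mulrBr normrM normfV.
rewrite ler_pdivrMl ?normr_gt0// [`|h| * e]mulrC [h + t]addrC; apply: dphih.
move: ht; rewrite /= in_itv/= lt_min ltr_norml.
by move=> /andP[/andP[? ?]]; rewrite ltr_norml => /andP[? ?]; lra.
Unshelve. all: by end_near. Qed.

Lemma has_derivative_within_continuous (R : realType) (phi psi : R -> R) :
  (forall t, t \in `[0, 1]%R ->
    @has_derivative_within R R^o [set` `[(0 : R), 1]] phi t
      (fun s => s * psi t)) ->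
  {within [set` `[(0 : R), 1]], continuous phi}.
Proof.
move=> dphi; apply/subspace_continuousP => t t01.
apply/cvgrPdist_lt => e e0.
have c0 : 0 < `|psi t| + 1 by rewrite ltr_wpDl.
have := dphi _ t01 _ ltr01; rewrite near_withinE => dphi1.
rewrite near_withinE; near=> s => s01; rewrite /from_subspace.
have : `|phi s - phi t - (s - t) * psi t| <= `|s - t|.
  by rewrite -[leRHS]mul1r; apply: (near dphi1 s _ s01).
move=> dphis; rewrite distrC -(subrK ((s - t) * psi t) (phi s - phi t)).
apply: le_lt_trans (ler_normD _ _) _.
apply: (@le_lt_trans _ _ (`|s - t| * (`|psi t| + 1))).
  by rewrite normrM mulrDr mulr1 addrC lerD2l.
rewrite -ltr_pdivlMr// distrC; near: s.
by apply: cvgr_dist_lt; rewrite ?divr_gt0//; exact: cvg_id.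
Unshelve. all: by end_near. Qed.

(** The mean value theorem is applied to the restriction [phi] of [d] to the
    segment from [x] to [y], from which the quadratic [q] is subtracted: strong
    monotonicity bounds the derivative of [phi] below by that of [q]. *)
Lemma bregman_ge (R : realType) (E : normedModType R) (X : set E)
    (d : E -> R) (gradd : E -> {linear E -> R^o}) :
  convex_set X -> is_C1_on X d gradd -> strongly_convex1_on X gradd ->
  forall x y, X x -> X y -> `|x - y| ^+ 2 / 2 <= bregman d gradd x y.
Proof.
move=> convX [C1d _] strongd x y Xx Xy.
pose phi (t : R) := d (x + t *: (y - x)).
pose psi (t : R) : R := gradd (x + t *: (y - x)) (y - x).
have dphi (t : R) : t \in `[(0 : R), 1] -> @has_derivative_within R R^o
    [set` `[(0 : R), 1]] phi t (fun s => s * psi t).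
  move=> t01; apply: (has_derivative_within_segment convX Xx Xy).
  exact: C1d (convex_segment convX Xx Xy t01).
pose gx : R := gradd x (y - x).
pose q (t : R) : R := t * gx + t ^+ 2 * (`|x - y| ^+ 2 / 2).
pose dq (t : R) : R := gx + t * `|x - y| ^+ 2.
have derq (t : R) : is_derive t 1 q (dq t).
  rewrite /q /dq; apply: is_derive_eq.
  by rewrite /GRing.scale /=; field.
have derB (t : R) : t \in `](0 : R), 1[ ->
    is_derive (t : R) (1 : R) (phi \- q : R -> R) (psi t - dq t).
  move=> t01; apply: is_deriveB; apply: (has_derivative_within_is_derive t01).
  by apply: dphi; exact: subset_itv_oo_cc t01.
have contB : {within `[(0 : R), 1], continuous (phi \- q)}.
  move=> t; apply: cvgB; first exact: (has_derivative_within_continuous dphi).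
  apply: continuous_subspaceT => s.
  apply/differentiable_continuous/derivable1_diffP.
  exact: (@ex_derive _ _ _ _ _ _ _ (derq s)).
have [t t01] := MVT ltr01 derB contB.
have psidq : dq t <= psi t.
  move: (t01); rewrite in_itv/= => /andP[t0 t1].
  have Xt : X (x + t *: (y - x)).
    by apply: convex_segment => //; exact: subset_itv_oo_cc t01.
  have lin z : gradd z (t *: (y - x)) = t * gradd z (y - x) :> R.
    by rewrite linearZ.
  have : t ^+ 2 * `|x - y| ^+ 2 <= t * psi t - t * gx.
    have := strongd _ _ Xt Xx.
    rewrite [_ - x]addrAC subrr add0r !lin normrZ (gtr0_norm t0) exprMn.
    by rewrite distrC.
  by move=> ?; rewrite /dq -(ler_pM2l t0); lra.
rewrite /= subr0 mulr1 /phi /q !scale1r scale0r addr0 subrKC.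
rewrite /bregman => H; lra.
Qed.

(** First-order optimality condition over a convex set. *)
Lemma argmin_first_order (R : realType) (E : normedModType R) (X : set E)
    (F : E -> R) (z u : E) (L : E -> R) :
  convex_set X -> is_argmin X F z -> X u ->
  (forall (a : R) v, L (a *: v) = a * L v) ->
  has_derivative_within X F z L -> 0 <= L (u - z).
Proof.
move=> convX [Xz minz] Xu LZ dF.
have c0 : 0 < `|u - z| + 1 by rewrite ltr_wpDl.
apply/ler_addgt0Pr => e e0.
have := dF _ (divr_gt0 e0 c0); rewrite near_withinE => dFe.
have : z + s *: (u - z) @[s --> (0 : R)] --> z + (0 : R) *: (u - z).
  by apply: cvgD; [exact: cvg_cst|exact: cvgZr_tmp].
rewrite scale0r addr0 => cont.
have /cvg_at_right_filter := cont => /(_ _ dFe) dFt.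
near ((0 : R)^'+) => t.
have t0 : 0 < t by near: t; exact: nbhs_right_gt.
have t1 : t <= 1 by near: t; exact: nbhs_right_le.
have Xt : X (z + t *: (u - z)).
  by apply: convex_segment => //; rewrite in_itv/= (ltW t0).
have : X (z + t *: (u - z)) -> `|F (z + t *: (u - z)) - F z
    - L (z + t *: (u - z) - z)| <= e / (`|u - z| + 1) *
     `|z + t *: (u - z) - z| by near: t.
have -> : z + t *: (u - z) - z = t *: (u - z).
  by rewrite addrAC subrr add0r.
move=> /(_ Xt); rewrite LZ normrZ (gtr0_norm t0).
rewrite ler_norml => /andP[_]; rewrite lerBlDr => Ft.
have : 0 <= t * (e / (`|u - z| + 1) * `|u - z| + L (u - z)).
  rewrite mulrDr mulrCA; apply: le_trans Ft; rewrite subr_ge0; exact: minz.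
rewrite pmulr_rge0// => /le_trans; apply.
rewrite addrC lerD2l -mulrA ler_piMr ?(ltW e0)//.
by rewrite mulrC ler_pdivrMr// mul1r lerDl.
Unshelve. all: by end_near. Qed.

(** * One step of mirror descent *)

(** The basic inequality of mirror descent. *)
Lemma mirr_step_le (R : realType) (E : normedModType R) (X : set E)
    (d : E -> R) (gradd : E -> {linear E -> R^o}) (p : {linear E -> R^o})
    (c : R) (z z' u : E) :
  finite_dimensional E -> convex_set X -> is_C1_on X d gradd ->
  strongly_convex1_on X gradd -> 0 <= c -> X z -> X u ->
  is_mirr X d gradd z (fun w => c * p w) z' ->
  c * p (z - u) <=
    (c * dual_norm p) ^+ 2 / 2 + bregman d gradd z u - bregman d gradd z' u.
Proof.
move=> finE convX C1d strongd c0 Xz Xu mirrz'.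
have Xz' : X z' by case: mirrz'.
pose G : E -> R := gradd z; pose G' : E -> R := gradd z'; pose P : E -> R := p.
have GB v w : G (v - w) = G v - G w by exact: linearB.
have G'B v w : G' (v - w) = G' v - G' w by exact: linearB.
have PB v w : P (v - w) = P v - P w by exact: linearB.
have VE y : bregman d gradd z y = d y - d z - G (y - z) by [].
have V'E y : bregman d gradd z' y = d y - d z' - G' (y - z') by [].
have opt : 0 <= c * P (u - z') + G' (u - z') - G (u - z').
  pose L v := c * P v + G' v - G v.
  apply: (argmin_first_order (L := L) convX mirrz' Xu) => [a v|e e0].
    have PZ : P (a *: v) = a * P v by rewrite /P linearZ.
    have GZ : G (a *: v) = a * G v by rewrite /G linearZ.
    have G'Z : G' (a *: v) = a * G' v by rewrite /G' linearZ.
    by rewrite /L PZ GZ G'Z; ring.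
  (* Up to an affine function of y, the objective is d. *)
  have := C1d.1 _ Xz' _ e0; apply: filterS => y.
  congr (`|_| <= _).
  change (d y - d z' - G' (y - z') = c * P y + bregman d gradd z y
    - (c * P z' + bregman d gradd z z') - L (y - z')).
  by rewrite !VE /L !PB !GB !G'B; ring.
have := bregman_ge convX C1d strongd Xz Xz'; rewrite VE.
have : c * P (z - z') <= c * (dual_norm p * `|z - z'|).
  by rewrite ler_wpM2l// dual_norm_ge.
change (c * p (z - u)) with (c * P (z - u)).
(* Young's inequality for the product of c |p|_* and |z - z'|. *)
have := sqr_ge0 (c * dual_norm p - `|z - z'|).
move: opt; rewrite V'E VE !PB !GB !G'B => *; nra.
Qed.

Lemma productive_step_le (R : realType) (E : normedModType R) (X : set E)
    (d : E -> R) (gradd gradf : E -> {linear E -> R^o}) (eps : R)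
    (z z' u : E) :
  finite_dimensional E -> convex_set X -> is_C1_on X d gradd ->
  strongly_convex1_on X gradd -> 0 <= eps -> X z -> X u ->
  (gradf z : E -> R) <> cst 0 ->
  is_mirr X d gradd z (fun w => eps / dual_norm (gradf z) * gradf z w) z' ->
  eps * v_f gradf z u <=
    eps ^+ 2 / 2 + bregman d gradd z u - bregman d gradd z' u.
Proof.
move=> finE convX C1d strongd eps0 Xz Xu gf0 mirrz'.
have D0 := dual_norm_gt0 finE gf0.
have := mirr_step_le finE convX C1d strongd _ Xz Xu mirrz'.
rewrite divr_ge0 ?(ltW D0)// divfK ?gt_eqF// => /(_ isT).
by rewrite /v_f asboolF// -mulrA [_^-1 * _]mulrC.
Qed.

Lemma nonproductive_step_lt (R : realType) (E : normedModType R) (X : set E)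
    (d : E -> R) (gradd : E -> {linear E -> R^o}) (h : E -> R)
    (s : {linear E -> R^o}) (eps : R) (z z' u : E) :
  finite_dimensional E -> convex_set X -> is_C1_on X d gradd ->
  strongly_convex1_on X gradd -> 0 < eps -> X z -> X u ->
  is_subgradient X h z s -> (s : E -> R) <> cst 0 -> eps < h z -> h u <= 0 ->
  is_mirr X d gradd z (fun w => eps / dual_norm s ^+ 2 * s w) z' ->
  eps ^+ 2 / 2 * (dual_norm s ^+ 2)^-1 <
    bregman d gradd z u - bregman d gradd z' u.
Proof.
move=> finE convX C1d strongd eps0 Xz Xu subh s0 hz hu mirrz'.
have D0 := dual_norm_gt0 finE s0; set D := dual_norm s in D0 mirrz' *.
have c0 : 0 < eps / D ^+ 2 by rewrite divr_gt0// exprn_gt0.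
have := mirr_step_le finE convX C1d strongd (ltW c0) Xz Xu mirrz'.
have szu : eps < s (z - u).
  have suz : s (u - z) = - (s (z - u)) :> R by rewrite -opprB linearN.
  have := subh _ Xu; rewrite suz => ?; lra.
have -> : (eps / D ^+ 2 * D) ^+ 2 / 2 = eps ^+ 2 / 2 * (D ^+ 2)^-1.
  by field; rewrite gt_eqF.
have : eps / D ^+ 2 * eps < eps / D ^+ 2 * s (z - u) by rewrite ltr_pM2l.
have -> : eps / D ^+ 2 * eps = 2 * (eps ^+ 2 / 2 * (D ^+ 2)^-1).
  by field; rewrite gt_eqF.
move=> *; lra.
Qed.

(** * Analysis of the algorithm *)

(** The contribution of an iteration to the sum in the stopping criterion. *)
Definition step_weight (R : realType) (E : normedModType R) (M : nat)
    (g : 'I_M.+1 -> E -> R) (gradg : 'I_M.+1 -> E -> {linear E -> R^o})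
    (eps : R) (z : E) (m : 'I_M.+1) : R :=
  if productive g eps z then 1 else (dual_norm (gradg m z) ^+ 2)^-1.

Lemma algB_stopP (R : realType) (E : normedModType R) (M : nat)
    (g : 'I_M.+1 -> E -> R) (gradg : 'I_M.+1 -> E -> {linear E -> R^o})
    (eps Theta0 : R) (x : nat -> E) (m : nat -> 'I_M.+1) (N : nat) :
  algB_stop g gradg eps Theta0 x m N <->
  Theta0 ^+ 2 <=
    eps ^+ 2 / 2 * \sum_(k < N) step_weight g gradg eps (x k) (m k).
Proof.
rewrite /algB_stop; set S := _ + _; set W := \sum_(k < N) _.
suff -> : S = W by [].
rewrite /W (bigID (fun k : 'I_N => productive g eps (x k)))/=; congr (_ + _).
  rewrite -sumr_const; apply: eq_big => // k; rewrite inE => Pk.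
  by rewrite /step_weight Pk.
by apply: eq_bigr => k /negbTE nPk; rewrite /step_weight nPk.
Qed.

Lemma algB_run_in (R : realType) (E : normedModType R) (X : set E)
    (d : E -> R) (gradd gradf : E -> {linear E -> R^o}) (M : nat)
    (g : 'I_M.+1 -> E -> R) (gradg : 'I_M.+1 -> E -> {linear E -> R^o})
    (eps Theta0 : R) (x : nat -> E) (m : nat -> 'I_M.+1) (N : nat) :
  algB_run X d gradd gradf g gradg eps Theta0 x m N ->
  forall k, (k <= N)%N -> X (x k).
Proof.
move=> [[Xx0 _] run] [//|k] /run[_]; rewrite /algB_step.
by case: ifP => _; [case=> _ []|case=> _ _ []].
Qed.

(** The divergence of a point from a minimiser of the prox function is at most
    the value of that function there, provided that its minimum is
    nonnegative. *)
Lemma bregman_argmin_le (R : realType) (E : normedModType R) (X : set E)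
    (d : E -> R) (gradd : E -> {linear E -> R^o}) (z u : E) :
  convex_set X -> is_C1_on X d gradd -> is_argmin X d z -> X u -> 0 <= d z ->
  bregman d gradd z u <= d u.
Proof.
move=> convX C1d minz Xu dz0; pose G : E -> R := gradd z.
have : 0 <= G (u - z).
  apply: (argmin_first_order convX minz Xu) => [a v|].
    by rewrite /G linearZ.
  exact: C1d.1 minz.1.
have -> : bregman d gradd z u = d u - d z - G (u - z) by [].
move=> ?; lra.
Qed.

(** If the stopping criterion holds and no productive step has a [v_f] below
    [eps], then the summed inequalities are all equalities.  The slack of step
    [k] is [b k]. *)
Lemma algB_stop_tight (R : realType) (E : normedModType R) (X : set E)
    (d : E -> R) (gradd gradf : E -> {linear E -> R^o}) (M : nat)
    (g : 'I_M.+1 -> E -> R) (gradg : 'I_M.+1 -> E -> {linear E -> R^o})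
    (eps Theta0 : R) (x : nat -> E) (m : nat -> 'I_M.+1) (N : nat) (xs : E) :
  finite_dimensional E -> convex_set X ->
  (forall m x, X x -> is_subgradient X (g m) x (gradg m x)) ->
  is_C1_on X d gradd -> strongly_convex1_on X gradd ->
  0 <= d (x 0%N) -> feasible X g xs -> d xs <= Theta0 ^+ 2 -> 0 < eps ->
  algB_run X d gradd gradf g gradg eps Theta0 x m N ->
  algB_stop g gradg eps Theta0 x m N ->
  (forall k, (k < N)%N -> productive g eps (x k) ->
     eps <= v_f gradf (x k) xs) ->
  tight_run d g eps Theta0 x xs N /\
  forall k, (k < N)%N -> v_f gradf (x k) xs = eps.
Proof.
move=> finE convX gradgP C1d strongd dx0 [Xxs gxs] dxs eps0 run.
move=> /algB_stopP stop vge; set W := \sum_(k < N) _ in stop.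
have Xx := algB_run_in run.
pose V k := bregman d gradd (x k) xs.
pose w (k : nat) := step_weight g gradg eps (x k) (m k).
have stepP k : (k < N)%N -> productive g eps (x k) ->
    eps * v_f gradf (x k) xs <= eps ^+ 2 / 2 + V k - V k.+1.
  move=> kN Pk; have [_] := run.2 _ kN; rewrite /algB_step Pk => -[gf0 mirr].
  by apply: productive_step_le mirr => //; [exact: ltW|exact: Xx (ltnW kN)].
have stepN k : (k < N)%N -> ~~ productive g eps (x k) ->
    eps ^+ 2 / 2 * w k < V k - V k.+1.
  move=> kN nPk; have [_] := run.2 _ kN.
  rewrite /algB_step /w /step_weight (negbTE nPk) => -[gk gg0 mirr].
  have Xk := Xx _ (ltnW kN).
  exact: nonproductive_step_lt Xk Xxs (gradgP _ _ Xk) gg0 gk (gxs _) mirr.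
pose b (k : nat) := V k - V k.+1 - eps ^+ 2 / 2 * w k.
have b_ge0 k : (k < N)%N -> 0 <= b k.
  move=> kN; rewrite subr_ge0.
  have [Pk|/(stepN _ kN)/ltW//] := boolP (productive g eps (x k)).
  have := stepP _ kN Pk; have : eps * eps <= eps * v_f gradf (x k) xs.
    by rewrite ler_pM2l// vge.
  by rewrite /w /step_weight Pk => *; lra.
have sumb : \sum_(k < N) b k = V 0%N - V N - eps ^+ 2 / 2 * W.
  rewrite /b sumrB -mulr_sumr; congr (_ - _).
  rewrite -(big_mkord xpredT (fun k => V k - V k.+1)) -opprB.
  rewrite -telescope_sumr// -sumrN.
  by apply: eq_bigr => k _; rewrite opprB.
have V0 : V 0%N <= d xs by apply: (bregman_argmin_le convX C1d run.1).
have VN : `|x N - xs| ^+ 2 / 2 <= V N by exact: bregman_ge (Xx _ _) Xxs.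
have VN0 : 0 <= V N by apply: le_trans VN; rewrite divr_ge0// sqr_ge0.
have sumb_ge0 : 0 <= \sum_(k < N) b k by apply: sumr_ge0 => k _; exact: b_ge0.
(* The criterion bounds the sum above by V 0 - V N - Theta0^2, and
   V 0 <= d xs <= Theta0^2. *)
have sumb0 : \sum_(k < N) b k = 0 by lra.
have b0 k : (k < N)%N -> b k = 0.
  move=> kN; have := psumr_eq0P _ sumb0 (i := Ordinal kN).
  by apply=> // i _; exact: b_ge0.
have Pall k : (k < N)%N -> productive g eps (x k).
  move=> kN; apply/negPn/negP => /(stepN _ kN).
  by rewrite -subr_gt0 -/(b k) b0// ltxx.
have WE : W = N%:R.
  rewrite /W (eq_bigr (fun=> 1)); last by move=> k _; rewrite /step_weight Pall.
  by rewrite sumr_const card_ord.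
split; last first.
  move=> k kN; apply/eqP; rewrite eq_le vge ?Pall// andbT.
  rewrite -(ler_pM2l eps0); have := stepP _ kN (Pall _ kN).
  have := b0 _ kN; rewrite /b /w /step_weight Pall// => *; lra.
(* Since the sum vanishes, V N = 0 and V 0 = d xs = Theta0^2 = eps^2 W / 2. *)
split=> //; [|lra|by rewrite -WE; lra].
apply/eqP; rewrite -subr_eq0 -normr_eq0 -sqrf_eq0 eq_le sqr_ge0 andbT; lra.
Qed.

(** A subgradient of a Lipschitz function at an interior point of the domain is
    bounded by the Lipschitz constant: the subgradient inequality is used at
    [x + t *: v] for a small positive [t]. *)
Lemma interior_subgradient_le (R : realType) (E : normedModType R)
    (X : set E) (f : E -> R) (x : E) (s : {linear E -> R^o}) (C : R) :
  X° x -> is_subgradient X f x s -> C.-lipschitz_X (f : E -> R^o) ->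
  forall v, s v <= C * `|v|.
Proof.
move=> Xx subf lipf v.
have : x + t *: v @[t --> (0 : R)] --> x + (0 : R) *: v.
  by apply: cvgD; [exact: cvg_cst|exact: cvgZr_tmp].
rewrite scale0r addr0 => cont.
have /cvg_at_right_filter := cont => /(_ _ Xx) Xt.
near ((0 : R)^'+) => t.
have t0 : 0 < t by near: t; exact: nbhs_right_gt.
have Xxt : X (x + t *: v) by near: t.
have Dt : x + t *: v - x = t *: v by rewrite addrAC subrr add0r.
have := lipf (x + t *: v, x) (conj Xxt (nbhs_singleton Xx)).
rewrite /= Dt normrZ (gtr0_norm t0) => /(le_trans (ler_norm _)) fle.
have := subf _ Xxt; rewrite Dt -lerBrDl => /le_trans/(_ fle).
by rewrite linearZ mulrCA ler_pM2l.
Unshelve. all: by end_near. Qed.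

Lemma step_weight_ge (R : realType) (E : normedModType R) (M : nat)
    (g : 'I_M.+1 -> E -> R) (gradg : 'I_M.+1 -> E -> {linear E -> R^o})
    (eps : R) (z : E) (m : 'I_M.+1) (C : R) :
  finite_dimensional E ->
  (~~ productive g eps z -> (gradg m z : E -> R) <> cst 0 /\
     dual_norm (gradg m z) <= C) ->
  (Num.max 1 (C ^+ 2))^-1 <= step_weight g gradg eps z m.
Proof.
move=> finE gC; rewrite /step_weight; case: ifPn => [_|/gC[gg0 gleC]].
  by rewrite invf_le1 ?le_max ?lexx// lt_max ltr01.
have D0 := dual_norm_gt0 finE gg0.
have C0 := le_trans (ltW D0) gleC.
rewrite lef_pV2; first 1 last.
- by rewrite posrE lt_max ltr01.
- by rewrite posrE exprn_gt0.
by rewrite le_max ler_pXn2r ?nnegrE ?(ltW D0)// gleC orbT.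
Qed.

Theorem theorem2 (R : realType) (E : normedModType R)
  (finE : finite_dimensional E)
  (X : set E) (closedX : closed X) (convexX : convex_set X)
  (f : E -> R) (M : nat) (g : 'I_M.+1 -> E -> R)
  (convexf : convex_function X f)
  (convexg : forall m, convex_function X (g m))
  (gradf : E -> {linear E -> R^o})
  (gradfP : forall x, X x -> is_subgradient X f x (gradf x))
  (gradg : 'I_M.+1 -> E -> {linear E -> R^o})
  (gradgP : forall m x, X x -> is_subgradient X (g m) x (gradg m x))
  (Mg : R) (lipg : forall m, Mg.-lipschitz_X (g m : E -> R^o))
  (d : E -> R) (gradd : E -> {linear E -> R^o})
  (C1d : is_C1_on X d gradd) (strongd : strongly_convex1_on X gradd)
  (min_d : is_argmin X d 0)
  (d0_ge0 : 0 <= d 0) (* normalisation of the prox function *)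
  (xs : E) (xs_sol : is_argmin (feasible X g) f xs)
  (Theta0 : R) (Theta0_gt0 : 0 < Theta0) (dxs : d xs <= Theta0 ^+ 2)
  (eps : R) (eps_gt0 : 0 < eps)
  (x : nat -> E) (m : nat -> 'I_M.+1) (N : nat)
  (run : algB_run X d gradd gradf g gradg eps Theta0 x m N) :
  (algB_stop g gradg eps Theta0 x m N ->
     (min_v_f gradf g eps x xs N <= eps%:E)%E /\
     (~ tight_run d g eps Theta0 x xs N ->
        (min_v_f gradf g eps x xs N < eps%:E)%E)) /\
  ((forall k, (k < N)%N -> ~~ productive g eps (x k) -> ~ (X°) (x k) ->
      dual_norm (gradg (m k) (x k)) <= Mg) ->
   N%:Z <= Num.ceil (2 * Num.max 1 (Mg ^+ 2) * Theta0 ^+ 2 / eps ^+ 2)).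
Proof.
have Xx := algB_run_in run.
split=> [stop|gradg_le].
  have dx0 : 0 <= d (x 0%N).
    by apply: le_trans d0_ge0 _; apply: min_d.2; exact: run.1.1.
  have tight := algB_stop_tight finE convexX gradgP C1d strongd dx0 xs_sol.1
    dxs eps_gt0 run stop.
  split.
    rewrite leNgt; apply/negP => /bigmin_gtP[_ vgt].
    have {}vgt k : (k < N)%N -> productive g eps (x k) ->
        eps < v_f gradf (x k) xs.
      by move=> kN; rewrite -lte_fin; exact: vgt (Ordinal kN).
    have [|[Pall _ _ ThetaE] veq] := tight.
      by move=> k kN /(vgt _ kN)/ltW.
    have N0 : (0 < N)%N.
      rewrite lt0n; apply/eqP => N0; move: ThetaE; rewrite N0 mulr0 => /eqP.
      by rewrite sqrf_eq0 gt_eqF.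
    by have := vgt _ N0 (Pall _ N0); rewrite veq// ltxx.
  move=> not_tight; rewrite ltNge; apply/negP => /bigmin_geP[_ vge].
  apply: not_tight; apply: (tight _).1 => k kN.
  by rewrite -lee_fin; exact: vge (Ordinal kN).
move: run Xx gradg_le; case: N => [|N] run Xx gradg_le.
  rewrite -[0%N%:Z]/(0 : int) ceil_ge0.
  apply: lt_le_trans (ltrN10 _) _.
  by rewrite divr_ge0 ?sqr_ge0// mulr_ge0 ?sqr_ge0// mulr_ge0// le_max ler01.
(* The criterion fails after N of the N.+1 iterations. *)
have [nstop _] := run.2 N (ltnSn N).
set C := Num.max 1 (Mg ^+ 2).
have C0 : 0 < C by rewrite lt_max ltr01.
move/(contra_not (iffRL (algB_stopP _ _ _ _ _ _ _)))/negP: nstop.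
rewrite -ltNge => nstop.
have : N%:R * C^-1 <= \sum_(k < N) step_weight g gradg eps (x k) (m k).
  rewrite mulrC mulr_natr -[N in leLHS]card_ord -sumr_const.
  apply: ler_sum => k _.
  have kN : (k < N.+1)%N := ltn_trans (ltn_ord k) (ltnSn N).
  apply: step_weight_ge => // nPk.
  have [_] := run.2 _ kN; rewrite /algB_step (negbTE nPk) => -[_ gg0 _].
  split=> //; have [Xk|nXk] := pselect (X° (x k)); last exact: gradg_le.
  apply: dual_norm_le => //.
  exact: interior_subgradient_le Xk (gradgP _ _ (Xx _ (ltnW kN))) (lipg _).
have e20 : 0 < eps ^+ 2 / 2 by rewrite divr_gt0// exprn_gt0.
rewrite -(ler_pM2l e20) => /le_lt_trans/(_ nstop) NC.
rewrite intS lez1D ceil_gt_int ltr_pdivlMr ?exprn_gt0//.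
move: NC; rewrite mulrA ltr_pdivrMr// => NC.
rewrite -pmulrn; lra.
Qed.
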